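(* Let $k\ge1$, $s=Be^\star$ with $e^\star\in\mathcal H$, $\|e^\star\|_{0,\mathrm g}\le k$, and suppose $\gamma_k(B)>0$. Then every minimizer of $$\min_{e\in\mathcal H}\ \|e\|_{0,\mathrm g}\quad\text{subject to}\quad Be=s$$ equals $e^\star$.
   Context: Let $V=\{1,\dots,n\}$, let $\mathcal H_i$ ($i\in V$) be finite-dimensional real Hilbert spaces, $\mathcal H=\bigoplus_{i\in V}\mathcal H_i$ (with $\mathcal H\ne\{0\}$) with $\|h\|_2^2=\sum_i\|h_i\|_2^2$, and group sparsity $\|h\|_{0,\mathrm g}=|\{i:h_i\neq0\}|$. $B$, given by $Bh=(Dh,\,Ah)$, is a linear operator from $\mathcal H$ to a finite-dimensional real Hilbert space, where $(Dz)_e=\sqrt{w_e}(z_j-T_ez_i)$ for the edges $e=(i,j)$ of a finite directed multigraph on $V$ with weights $w_e>0$ and linear maps $T_e:\mathcal H_i\to\mathcal H_j$, and $A$ is an arbitrary linear map on $\mathcal H$. The margin is $\gamma_k(B)=\min\{\|Bh\|_2/\|h\|_2:h\neq0,\ \|h\|_{0,\mathrm g}\le2k\}$. *)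

(* Defs.v *)
From HB Require Import structures.
From mathcomp Require Import all_boot all_order all_algebra sesquilinear.
From mathcomp Require Import all_classical all_reals all_analysis.

Set Implicit Arguments.
Unset Strict Implicit.
Unset Printing Implicit Defensive.

Import Order.TTheory GRing.Theory Num.Theory.
Import numFieldNormedType.Exports.
Import VectorInternalTheory.

Local Open Scope classical_set_scope.
Local Open Scope ring_scope.

(* A finite-dimensional real Hilbert space is a vectType over a realType with
   a symmetric positive definite bilinear form, that is a {dot V for idfun}. *)

Notation dsum H := {dffun forall i, H i}.

Section DirectSum.
Context {R : realType} {I : finType} {H : I -> vectType R}.
Implicit Types (h g : dsum H) (a b : R).

Definition dsum0 : dsum H := [ffun i => 0 : H i].
Definition dsumN h : dsum H := [ffun i => - h i].
Definition dsumD h g : dsum H := [ffun i => h i + g i].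
Definition dsumZ a h : dsum H := [ffun i => a *: h i].

Fact dsumA : associative dsumD.
Proof. by move=> x y z; apply/ffunP => i; rewrite !ffunE addrA. Qed.
Fact dsumC : commutative dsumD.
Proof. by move=> x y; apply/ffunP => i; rewrite !ffunE addrC. Qed.
Fact dsum0D : left_id dsum0 dsumD.
Proof. by move=> x; apply/ffunP => i; rewrite !ffunE add0r. Qed.
Fact dsumND : left_inverse dsum0 dsumN dsumD.
Proof. by move=> x; apply/ffunP => i; rewrite !ffunE addNr. Qed.

HB.instance Definition _ :=
  GRing.isZmodule.Build (dsum H) dsumA dsumC dsum0D dsumND.

Fact dsumZA a b h : dsumZ a (dsumZ b h) = dsumZ (a * b) h.
Proof. by apply/ffunP => i; rewrite !ffunE scalerA. Qed.
Fact dsum1Z : left_id 1 dsumZ.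
Proof. by move=> x; apply/ffunP => i; rewrite !ffunE scale1r. Qed.
Fact dsumZDr : right_distributive dsumZ +%R.
Proof. by move=> a x y; apply/ffunP => i; rewrite !ffunE scalerDr. Qed.
Fact dsumZDl h : {morph dsumZ^~ h : a b / a + b}.
Proof. by move=> a b; apply/ffunP => i; rewrite !ffunE scalerDl. Qed.

HB.instance Definition _ :=
  GRing.Zmodule_isLmodule.Build R (dsum H) dsumZA dsum1Z dsumZDr dsumZDl.

Lemma dsum0E i : (0 : dsum H) i = 0. Proof. exact: ffunE. Qed.
Lemma dsumDE h g i : (h + g) i = h i + g i. Proof. exact: ffunE. Qed.
Lemma dsumZE a h i : (a *: h) i = a *: h i. Proof. exact: ffunE. Qed.

Let J := {i : I & 'I_(dim (H i))}.

Fact dsum_vect_iso : Vector.axiom #|{: J}| (dsum H).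
Proof.
pose fr h : 'rV[R]_#|{: J}| :=
  \row_p v2r (h (tag (enum_val p))) 0 (tagged (enum_val p)).
exists fr; first by move=> a h g; apply/rowP => p; rewrite !mxE dsumDE dsumZE linearP !mxE.
exists (fun c : 'rV[R]_#|{: J}| =>
  [ffun i => r2v (\row_j c 0 (enum_rank (Tagged (fun i => 'I_(dim (H i))) j)))
             : H i] : dsum H) => [h|c].
  apply/ffunP => i; rewrite ffunE; apply: (can_inj v2rK); rewrite r2vK.
  by apply/rowP => j; rewrite !mxE enum_rankK.
apply/rowP => p; rewrite !mxE ffunE r2vK mxE.
by case: (enum_val p) (enum_valK p) => i j /= <-.
Qed.

HB.instance Definition _ := Lmodule_hasFinDim.Build R (dsum H) dsum_vect_iso.

Variable ip : forall i, {dot H i for idfun}.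

Definition dsum_dot h g : R := \sum_i ip i (h i) (g i).

Fact dsum_dot_bilinear : bilinear_for *%R *%R dsum_dot.
Proof.
split=> [g a h1 h2|h a g1 g2]; rewrite /dsum_dot /= mulr_sumr -big_split /=;
  apply: eq_bigr => i _; rewrite dsumDE dsumZE.
  by rewrite linearPl.
by rewrite linearPr.
Qed.

HB.instance Definition _ :=
  bilinear_isBilinear.Build R (dsum H) (dsum H) R *%R *%R dsum_dot
    dsum_dot_bilinear.

Fact dsum_dot_sym h g : dsum_dot h g = (-1) ^+ false * idfun (dsum_dot g h).
Proof.
rewrite expr0 mul1r; apply: eq_bigr => i _.
by rewrite hermitian_subproof expr0 mul1r.
Qed.

HB.instance Definition _ :=
  isHermitianSesquilinear.Build R (dsum H) false idfun dsum_dot dsum_dot_sym.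

Fact dsum_dot_gt0 h : h != 0 -> 0 < dsum_dot h h.
Proof.
have ge0 i : 0 <= ip i (h i) (h i).
  by have [->|/neq0_dnorm_gt0/ltW//] := eqVneq (h i) 0; rewrite linear0l.
move=> h0; rewrite lt_def sumr_ge0 ?andbT//; apply: contraNneq h0 => /eqP.
rewrite psumr_eq0 // => /allP s0; apply/eqP/ffunP => i; rewrite dsum0E.
apply: contraTeq (s0 i (mem_index_enum i)) => /neq0_dnorm_gt0 hi.
by rewrite gt_eqF //; exact: hi.
Qed.

HB.instance Definition _ :=
  isDotProduct.Build R (dsum H) dsum_dot dsum_dot_gt0.

End DirectSum.

Section ProdDot.
Context {R : realType} {U V : vectType R}.
Variables (f : {dot U for idfun}) (g : {dot V for idfun}).

Definition prod_dot (x y : U * V) : R := f x.1 y.1 + g x.2 y.2.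

Fact prod_dot_bilinear : bilinear_for *%R *%R prod_dot.
Proof.
by split=> [z a x y|z a x y]; rewrite /prod_dot /= ?linearPl ?linearPr /=
  mulrDr addrACA.
Qed.

HB.instance Definition _ :=
  bilinear_isBilinear.Build R (U * V)%type (U * V)%type R *%R *%R prod_dot
    prod_dot_bilinear.

Fact prod_dot_sym x y : prod_dot x y = (-1) ^+ false * idfun (prod_dot y x).
Proof.
by rewrite expr0 mul1r /prod_dot hermitian_subproof [g _ _]hermitian_subproof
  !expr0 !mul1r.
Qed.

HB.instance Definition _ :=
  isHermitianSesquilinear.Build R (U * V)%type false idfun prod_dot prod_dot_sym.

Fact prod_dot_gt0 x : x != 0 -> 0 < prod_dot x x.
Proof.
case: x => u v; rewrite /prod_dot /=.
have [->|/neq0_dnorm_gt0 u0 _] := eqVneq u 0.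
  have [->|/neq0_dnorm_gt0 v0 _] := eqVneq v 0; first by rewrite eqxx.
  by rewrite linear0l add0r; exact: v0.
have [->|/neq0_dnorm_gt0 v0] := eqVneq v 0; last by apply: addr_gt0; [exact: u0|exact: v0].
by rewrite linear0l addr0; exact: u0.
Qed.

HB.instance Definition _ :=
  isDotProduct.Build R (U * V)%type prod_dot prod_dot_gt0.

End ProdDot.

Definition norm2 {R : realType} {U : vectType R} (f : {dot U for idfun})
  (u : U) : R := Num.sqrt (f u u).

Definition gsparsity {R : realType} {I : finType} {H : I -> vectType R}
  (h : dsum H) : nat := #|[set i | h i != 0]%SET|.

Definition gsparsity_minimizer {R : realType} {I : finType}
    {H : I -> vectType R} {W : vectType R} (B : {linear dsum H -> W}) (s : W)
    (e : dsum H) : Prop :=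
  B e = s /\ forall e' : dsum H, B e' = s -> (gsparsity e <= gsparsity e')%N.

Section Operator.
Context {R : realType} {I E : finType} {H : I -> vectType R}.
Variables (src tgt : E -> I) (w : E -> R).
Variable T : forall e, {linear H (src e) -> H (tgt e)}.

Definition edge_op (z : dsum H) : dsum (fun e => H (tgt e)) :=
  [ffun e => Num.sqrt (w e) *: (z (tgt e) - T e (z (src e))) : H (tgt e)].

Fact edge_op_linear : linear edge_op.
Proof.
move=> a x y; apply/ffunP => e; rewrite !(ffunE, dsumDE, dsumZE) linearP.
by rewrite opprD addrACA -scalerBr scalerDr !scalerA mulrC.
Qed.

HB.instance Definition _ := GRing.isLinear.Build R _ _ _ edge_op edge_op_linear.

Variables (K : vectType R) (A : {linear dsum H -> K}).

Definition stack_op (h : dsum H) : dsum (fun e => H (tgt e)) * K :=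
  (edge_op h, A h).

Fact stack_op_linear : linear stack_op.
Proof. by move=> a x y; rewrite /stack_op !linearP. Qed.

HB.instance Definition _ := GRing.isLinear.Build R _ _ _ stack_op stack_op_linear.

End Operator.

Section Margin.
Context {R : realType} {I : finType} {H : I -> vectType R} {W : vectType R}.
Variables (ip : forall i, {dot H i for idfun}) (ipW : {dot W for idfun}).
Variables (k : nat) (B : {linear dsum H -> W}).

Definition margin_ratios : set R :=
  [set norm2 ipW (B h) / norm2 (dsum_dot ip) h
    | h in [set h : dsum H | h != 0 /\ (gsparsity h <= 2 * k)%N]].

(* The minimum is written as an infimum; it is attained, see margin_attained. *)
Definition margin : R := inf margin_ratios.

End Margin.
Section Attained.
Context {R : realType}.

Lemma continuous_sumR (X : topologicalType) (I : finType) (P : pred I)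
    (F : I -> X -> R) :
  (forall i, P i -> continuous (F i)) -> continuous (fun x => \sum_(i | P i) F i x).
Proof.
by apply: continuous_big => x; apply: cvgD; [exact: cvg_fst|exact: cvg_snd].
Qed.

Lemma continuous_prodR (X : topologicalType) (I : finType) (P : pred I)
    (F : I -> X -> R) :
  (forall i, P i -> continuous (F i)) -> continuous (fun x => \prod_(i | P i) F i x).
Proof.
by apply: continuous_big => x; apply: cvgM; [exact: cvg_fst|exact: cvg_snd].
Qed.

Lemma dot_continuous (U : vectType R) (f : {dot U for idfun}) n
    (L : 'rV[R]_n -> U) :
  linear L -> continuous (fun c => f (L c) (L c)).
Proof.
move=> linL.
pose mL := GRing.isLinear.Build R _ _ _ L linL.
pose LL : {linear 'rV[R]_n -> U} := HB.pack L mL.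
have LE c : L c = \sum_j c 0 j *: L (delta_mx 0 j).
  rewrite -[L]/(LL : _ -> _) {1}(row_sum_delta c) linear_sum.
  by apply: eq_bigr => j _; rewrite linearZ.
have -> : (fun c => f (L c) (L c)) = (fun c : 'rV[R]_n => \sum_i \sum_j
    (c 0 i * (c 0 j * f (L (delta_mx 0 i)) (L (delta_mx 0 j))))).
  apply/funext => c; rewrite [L c]LE linear_sumlz; apply: eq_bigr => i _.
  rewrite linear_sumr; apply: eq_bigr => j _.
  by rewrite linearZl_LR linearZr_LR.
apply: continuous_sumR => i _; apply: continuous_sumR => j _ c.
have cc l : {for c, continuous (fun x : 'rV[R]_n => x 0 l)}.
  exact: (@coord_continuous R 1 n 0 l c).
apply: (continuousM (cc i)); apply: (continuousM (cc j)).
exact: (@cst_continuous _ R _).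
Qed.

Lemma norm2_gt0 (U : vectType R) (f : {dot U for idfun}) u :
  u != 0 -> 0 < norm2 f u.
Proof. by move=> /(@neq0_dnorm_gt0 _ _ _ f) fu; rewrite sqrtr_gt0. Qed.

Lemma dot_ge0 (U : vectType R) (f : {dot U for idfun}) u : 0 <= f u u.
Proof.
by have [->|/(@neq0_dnorm_gt0 _ _ _ f)/ltW//] := eqVneq u 0; rewrite linear0l.
Qed.

Lemma norm2Z (U : vectType R) (f : {dot U for idfun}) a u :
  norm2 f (a *: u) = `|a| * norm2 f u.
Proof.
rewrite /norm2 linearZl_LR linearZr_LR /= mulrA -expr2 sqrtrM ?sqr_ge0//.
by rewrite sqrtr_sqr.
Qed.

Let v2r_lin (U : vectType R) : {linear U -> 'rV[R]_(dim U)} := @v2r R U.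
Let r2v_lin (U : vectType R) : {linear 'rV[R]_(dim U) -> U} := @r2v R U.

Context {I : finType} {H : I -> vectType R} {W : vectType R}.
Variables (ip : forall i, {dot H i for idfun}) (ipW : {dot W for idfun}).
Variables (k : nat) (B : {linear dsum H -> W}).

Lemma gsparsityZ a (h : dsum H) : a != 0 -> gsparsity (a *: h) = gsparsity h.
Proof.
move=> a0; apply: eq_card => i.
by rewrite !inE dsumZE scaler_eq0 (negPf a0).
Qed.

(* viol h vanishes iff the support of h lies in some S with #|S| <= 2 * k, so
   the sparsity constraint is the zero set of a continuous function. *)
Let viol (h : dsum H) : R :=
  \prod_(S : {set I} | (#|S| <= 2 * k)%N) \sum_(i in ~: S) ip i (h i) (h i).

Let viol_eq0 h : (viol h == 0) = (gsparsity h <= 2 * k)%N.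
Proof.
have ge0 i : 0 <= ip i (h i) (h i) by exact: dot_ge0.
apply/prodf_eq0/idP => [[S Sk]|hk].
  rewrite psumr_eq0 // => /allP S0; apply: leq_trans Sk; apply/subset_leq_card.
  apply/fintype.subsetP => i; rewrite inE => hi; apply: contraTT (S0 i (mem_index_enum i)).
  move=> iS; rewrite inE iS /= gt_eqF//.
  exact: (@neq0_dnorm_gt0 _ _ _ (ip i)).
exists [set i | h i != 0]%SET => //; rewrite big1 // => i.
by rewrite !inE negbK => /eqP ->; rewrite linear0l.
Qed.

Lemma margin_attained : (0 < k)%N -> (exists h : dsum H, h != 0) ->
  margin_ratios ip ipW k B (margin ip ipW k B).
Proof.
move=> k0 [h0 h0N0].
pose N := dim (dsum H).
pose v2 : {linear dsum H -> 'rV[R]_N} := v2r_lin (dsum H).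
pose rv : {linear 'rV[R]_N -> dsum H} := r2v_lin (dsum H).
have rvK : cancel rv v2 by move=> c; exact: r2vK.
have vrK : cancel v2 rv by move=> h; exact: v2rK.
pose q (c : 'rV[R]_N) : R :=
  ipW (B (rv c)) (B (rv c)) / dsum_dot ip (rv c) (rv c).
pose C := [set c : 'rV[R]_N | `|c| = 1] `&` [set c | viol (rv c) = 0].
have r2vN0 (c : 'rV[R]_N) : c != 0 -> rv c != 0.
  by apply: contra_neq => /(congr1 v2); rewrite rvK linear0.
have CN0 c : C c -> rv c != 0.
  by move=> [/= c1 _]; apply: r2vN0; rewrite -normr_gt0 c1.
have cC : compact C.
  apply: bounded_closed_compact.
    by exists 1; split=> // M M1 c [/= -> _]; exact: ltW.
  apply: closedI.
    apply: (@preimage_closed _ _ _ [set x : R | x = 1]) (@closed_eq _ _).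
    by move=> c _; exact: norm_continuous.
  apply: (@preimage_closed _ _ (fun c => viol (rv c)) [set x : R | x = 0])
    (@closed_eq _ _) => c _.
  apply: continuous_prodR => S _; apply: continuous_sumR => i _.
  apply: (dot_continuous (L := fun c => rv c i)) => a x y.
  by rewrite linearP dsumDE dsumZE.
have toC (h : dsum H) : h != 0 -> (gsparsity h <= 2 * k)%N ->
    exists2 c, C c & exists2 a, a != 0 & h = a *: rv c.
  move=> hN0 hk; have nh : `|v2 h| != 0 :> R.
    by rewrite normr_eq0; apply: contra_neq hN0 => /(congr1 rv); rewrite vrK linear0.
  exists (`|v2 h|^-1 *: v2 h); last first.
    by exists `|v2 h| => //; rewrite -[LHS]vrK linearZ scalerA divff// scale1r.
  split=> /=.
    by rewrite normrZ gtr0_norm ?invr_gt0 ?lt_def ?nh ?normr_ge0// mulVf.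
  apply/eqP; rewrite viol_eq0 linearZ vrK gsparsityZ ?invr_eq0//.
have [h1 h1N0 h1k] : exists2 h : dsum H, h != 0 & (gsparsity h <= 2 * k)%N.
  have [i hi] : exists i, h0 i != 0.
    apply/existsP; apply: contraNT h0N0 => /existsPn h00.
    by apply/eqP/ffunP => i; rewrite dsum0E; apply/eqP; rewrite -[_ == _]negbK h00.
  exists [ffun j => if j == i then h0 j else 0].
    by apply: contraNneq hi => /ffunP/(_ i); rewrite dsum0E ffunE eqxx => ->.
  apply: (@leq_trans 1%N); last by rewrite muln_gt0.
  rewrite -(cards1 i); apply/subset_leq_card/fintype.subsetP => j; rewrite !inE ffunE.
  by case: ifP => //; rewrite eqxx.
have C0 : C !=set0 by have [c Cc _] := toC h1 h1N0 h1k; exists c.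
have qcont : {within C, continuous q}.
  apply: continuous_in_subspaceT => c /set_mem/CN0 cN0.
  have cB : continuous (fun c => ipW (B (rv c)) (B (rv c))).
    by apply: (dot_continuous (L := fun c => B (rv c))) => a x y; rewrite !linearP.
  have cI : continuous (fun c => dsum_dot ip (rv c) (rv c)).
    by apply: (dot_continuous (L := rv)); exact: linearP.
  have I0 : dsum_dot ip (rv c) (rv c) != 0.
    by rewrite gt_eqF //; exact: dsum_dot_gt0.
  exact: (continuousM (cB c) (continuousV I0 (cI c))).
have [c /set_mem Cc cmin] := compact_EVT_min C0 cC qcont.
have qE c' : Num.sqrt (q c') =
    norm2 ipW (B (rv c')) / norm2 (dsum_dot ip) (rv c').
  by rewrite /q sqrtrM ?sqrtrV ?dot_ge0.
have cMin : lbound (margin_ratios ip ipW k B) (Num.sqrt (q c)).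
  move=> _ [h [hN0 hk] <-]; have [c' Cc' [a aN0 ->]] := toC h hN0 hk.
  rewrite linearZ !norm2Z -mulf_div divff ?normr_eq0// mul1r -qE.
  by apply: ler_wsqrtr; apply: cmin; exact: mem_set.
have cIn : margin_ratios ip ipW k B (Num.sqrt (q c)).
  exists (rv c); last by rewrite -qE.
  by split; [exact: CN0|rewrite -viol_eq0; case: Cc => _ /= ->].
suff -> : margin ip ipW k B = Num.sqrt (q c) by [].
apply/eqP; rewrite eq_le ge_inf//=; last by exists (Num.sqrt (q c)).
by apply: lb_le_inf => //; exists (Num.sqrt (q c)).
Qed.
End Attained.

(* Main.v *)
(* The difference of two k-sparse solutions is a 2k-sparse vector of the kernel
   of B; a positive margin at level 2k forces it to vanish. *)

Require Import Defs.
From mathcomp Require Import all_boot all_order all_algebra sesquilinear.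
From mathcomp Require Import all_classical all_reals all_analysis.
Import Order.TTheory GRing.Theory Num.Theory.
Local Open Scope ring_scope.

(** Since [estar] is feasible, a minimizer [e] is no less sparse than it, so both are supported on
    at most [k] groups. Subadditivity of group sparsity ([gsparsityB]) puts [e - estar] in the range
    of vectors over which the margin is taken, and a positive margin leaves no nonzero kernel vector
    there ([margin_gt0_inj]). *)

(** Where both blocks vanish, so does their difference: its support lies in the union of the two
    supports. *)
Lemma gsparsityB {R : realType} {I : finType} {H : I -> vectType R}
    (h g : dsum H) : (gsparsity (h - g)%R <= gsparsity h + gsparsity g)%N.
Proof.
apply: leq_trans (leq_card_setU _ _).
apply/subset_leq_card/fintype.subsetP => i; rewrite !inE -scaleN1r dsumDE dsumZE.
apply: contraNT; rewrite negb_or !negbK => /andP[/eqP-> /eqP->].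
by rewrite scaler0 addr0.
Qed.

(** A nonzero such [h] would contribute the ratio 0, so the infimum would be at most 0. *)
Lemma margin_gt0_inj {R : realType} {I : finType} {H : I -> vectType R}
    {W : vectType R} (ip : forall i, {dot H i for idfun})
    (ipW : {dot W for idfun}) (k : nat) (B : {linear dsum H -> W})
    (h : dsum H) :
  0 < margin ip ipW k B -> (gsparsity h <= 2 * k)%N -> B h = 0 -> h = 0.
Proof.
move=> m0 hk Bh0; apply/eqP/negPn/negP => hN0; move: m0; apply/negP.
rewrite -leNgt; apply: ge_inf.
  (* An infimum bounds its set from below only if the set has a lower bound; ratios of norms are
     nonnegative. *)
  by exists 0 => _ [g _ <-]; rewrite divr_ge0 ?sqrtr_ge0.
by exists h => //; rewrite Bh0 /norm2 linear0l sqrtr0 mul0r.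
Qed.

Theorem corollary15 (R : realType) (n : nat)
    (H : 'I_n -> vectType R) (ip : forall i, {dot H i for idfun})
    (H_neq0 : exists h : dsum H, h != 0)
    (E : finType) (src tgt : E -> 'I_n)
    (w : E -> R) (w_gt0 : forall e, 0 < w e)
    (T : forall e, {linear H (src e) -> H (tgt e)})
    (K : vectType R) (ipK : {dot K for idfun}) (A : {linear dsum H -> K})
    (k : nat) (k_ge1 : (1 <= k)%N)
    (estar : dsum H) (estar_sparse : (gsparsity estar <= k)%N)
    (s : dsum (fun e => H (tgt e)) * K) (sE : s = stack_op w T A estar)
    (margin_gt0 :
      0 < margin ip (prod_dot (dsum_dot (fun e => ip (tgt e))) ipK) k
            (stack_op w T A)) :
  forall e : dsum H,
    gsparsity_minimizer (stack_op w T A) s e -> e = estar.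
Proof.
move=> e [Be emin]; apply/eqP; rewrite -subr_eq0; apply/eqP.
apply: (margin_gt0_inj _ _ _ _ _ margin_gt0).
  apply: leq_trans (gsparsityB _ _) _; rewrite mul2n -addnn.
  (* Minimality of [e] is tested against the competitor [estar], feasible by [sE]. *)
  by apply: leq_add => //; apply: leq_trans estar_sparse; exact: emin.
by rewrite linearB /= -sE Be subrr.
Qed.
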